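(* Let $W$ be an NDCSE with respect to a closed abelian subgroup $H\subseteq G$, $\rho$ a density matrix, $\lambda$ an irrep of $G$ with $a^H_\lambda>0$, and $O$ a Hermitian operator in the $\lambda$-isotypic component of $\mathcal L^{\mathcal D}$. Suppose either (i) $O$ is positive semidefinite or negative semidefinite; or (ii) for some $(\eta,i)$ there is a $G$-irreducible submodule $E\subseteq\mathrm{End}(\mathcal H^{\eta,i})$ isomorphic to $\lambda$ with a Hilbert–Schmidt orthonormal basis $\{O_\beta\}$ of Hermitian operators all having the same operator norm, such that $R(g)O_\beta R(g)^\dagger\in\{O_{\beta'}\}_{\beta'}$ for all $g\in G$ and all $\beta$, each $O_\beta$ is either diagonal in $W$ or has all diagonal entries $\langle w|O_\beta|w\rangle$ equal to zero, and $O$ is one of the $O_\beta$. Then the single-shot estimator satisfies $\mathrm{Var}[\hat o]\le \|O\|_\infty^2/a^H_\lambda$.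
   Context: $G$ compact group with Haar measure; $R:G\to\mathsf U(\mathcal H)$ continuous unitary representation, $\dim\mathcal H<\infty$; $\mathcal L=\mathrm{End}(\mathcal H)$ with HS inner product and action $X\mapsto R(g)XR(g)^\dagger$. Measurement channel $\mathcal M_W(X)=\int_G R(g)^\dagger\mathcal A_W(R(g)XR(g)^\dagger)R(g)\,dg$, $\mathcal A_W(X)=\sum_w\langle w|X|w\rangle|w\rangle\langle w|$. An NDCSE w.r.t. abelian $H\subseteq G$ is an orthonormal basis $W=\bigcup_{\eta,i}W^{\eta,i}$ with $W^{\eta,i}$ an orthonormal basis of $\mathcal H^{\eta,i}$ for a decomposition $\mathcal H=\bigoplus\mathcal H^{\eta,i}$ into irreducible $G$-submodules, consisting of simultaneous eigenvectors of $R(H)$, with each $\mathcal H^{\eta,i}$ multiplicity-free under $H$. $\mathcal L^{\mathcal D}=\bigoplus\mathrm{End}(\mathcal H^{\eta,i})$. $a^H_\lambda=d^H_\lambda/d_\lambda$ with $d_\lambda=\dim V^\lambda$, $d^H_\lambda=\dim (V^\lambda)^H$. Estimator: $g\sim$ Haar, outcome $w$ with probability $\langle w|R(g)\rho R(g)^\dagger|w\rangle$, $\hat o=\mathrm{Tr}[O\,\mathcal M_W^+(R(g)^\dagger|w\rangle\langle w|R(g))]$ with $\mathcal M_W^+$ the Moore–Penrose pseudoinverse. *)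

(* Defs.v *)
(* MathComp + MathComp-Analysis (topology, reals) + real_closed complex. *)
From mathcomp Require Import all_boot all_order all_algebra.
From mathcomp Require Import complex.
From mathcomp Require Import all_classical all_reals all_analysis.
Set Implicit Arguments.
Unset Strict Implicit.
Unset Printing Implicit Defensive.
Import Order.TTheory GRing.Theory Num.Theory.
Import numFieldNormedType.Exports.
Local Open Scope ring_scope.

(* Complex numbers C := R[i] over a real type R, and matrix helpers.   *)

Definition reC (R : realType) (x : R[i]) : R := complex.Re x.
Definition imC (R : realType) (x : R[i]) : R := complex.Im x.

(* conjugate transpose A^dagger *)
Definition adj (R : realType) m k (A : 'M[R[i]]_(m, k)) : 'M[R[i]]_(k, m) :=
  (map_mx (fun x : R[i] => x^*) A)^T.

(* <v| A |u> *)
Definition braket (R : realType) n (v : 'cV[R[i]]_n) (A : 'M[R[i]]_n)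
  (u : 'cV[R[i]]_n) : R[i] := (adj v *m A *m u) 0 0.

Definition is_hermitian (R : realType) n (A : 'M[R[i]]_n) : Prop := adj A = A.

(* positive semidefinite: <v|A|v> is real and >= 0 for all v *)
Definition is_psd (R : realType) n (A : 'M[R[i]]_n) : Prop :=
  is_hermitian A /\ forall v : 'cV[R[i]]_n, 0 <= braket v A v.

Definition density_matrix (R : realType) n (rho : 'M[R[i]]_n) : Prop :=
  is_psd rho /\ \tr rho = 1.

(* squared Euclidean norm of a column vector *)
Definition vnorm2 (R : realType) n (v : 'cV[R[i]]_n) : R := reC ((adj v *m v) 0 0).

(* operator norm ||A||_infty = sup_{||v|| = 1} ||A v|| *)
Definition opnorm (R : realType) n (A : 'M[R[i]]_n) : R :=
  sup [set Num.sqrt (vnorm2 (A *m v)) | v in [set v : 'cV[R[i]]_n | vnorm2 v = 1]].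

(* Moore--Penrose pseudoinverse (Penrose conditions) *)
Definition is_pinv (R : realType) N (A P : 'M[R[i]]_N) : Prop :=
  [/\ A *m P *m A = A, P *m A *m P = P,
      adj (A *m P) = A *m P & adj (P *m A) = P *m A].

(* Compact (Hausdorff) topological groups and their Haar integral.     *)

Record cgroup (G : topologicalType) := CGroup {
  gmul : G -> G -> G;
  ginv : G -> G;
  gone : G;
  gmulA : forall x y z, gmul x (gmul y z) = gmul (gmul x y) z;
  gmul1 : forall x, gmul gone x = x;
  gmulV : forall x, gmul (ginv x) x = gone;
  gmul_cont : continuous (fun p : G * G => gmul p.1 p.2);
  ginv_cont : continuous ginv;
  g_compact : compact [set: G];
  g_hausdorff : hausdorff_space G
}.

(* The normalized (left) Haar integral on C(G): a positive, normalized,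
   left-invariant linear functional on continuous real functions
   (by the Riesz representation theorem, integration against Haar measure). *)
Definition haar_integral (R : realType) (G : topologicalType) (gr : cgroup G)
  (I : (G -> R) -> R) : Prop :=
  [/\ forall f g : G -> R, continuous f -> continuous g ->
        I (fun x => f x + g x) = I f + I g,
      forall (c : R) (f : G -> R), continuous f -> I (fun x => c * f x) = c * I f,
      forall f : G -> R, continuous f -> (forall x, 0 <= f x) -> 0 <= I f,
      I (fun _ => 1) = 1
    & forall (f : G -> R) (h : G), continuous f ->
        I (fun x => f (gmul gr h x)) = I f].

(* complex-valued and matrix-valued integrals *)
Definition cint (R : realType) (G : topologicalType) (I : (G -> R) -> R)
  (f : G -> R[i]) : R[i] :=
  Complex (I (fun g => reC (f g))) (I (fun g => imC (f g))).

Definition cintmx (R : realType) (G : topologicalType) (I : (G -> R) -> R)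
  m k (F : G -> 'M[R[i]]_(m, k)) : 'M[R[i]]_(m, k) :=
  \matrix_(i, j) cint I (fun g => F g i j).

(* continuity of a matrix-valued function (entrywise, real and imag parts) *)
Definition cont_mx (R : realType) (G : topologicalType) m k
  (F : G -> 'M[R[i]]_(m, k)) : Prop :=
  forall i j, continuous (fun g => reC (F g i j)) /\
              continuous (fun g => imC (F g i j)).

(* continuous unitary representation of G on C^d *)
Definition unitary_rep (R : realType) (G : topologicalType) (gr : cgroup G) d
  (rep : G -> 'M[R[i]]_d) : Prop :=
  [/\ forall x y, rep (gmul gr x y) = rep x *m rep y,
      forall x, adj (rep x) *m rep x = 1%:M
    & cont_mx rep].

(* Subspaces of C^d are row spaces of matrices (rows = transposed vectors);
   g acts on a column vector v by rep g *m v, i.e. on the row v^T by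
   v^T *m (rep g)^T. *)
Definition invariant_sub (R : realType) (G : topologicalType) d
  (rep : G -> 'M[R[i]]_d) k (S : 'M[R[i]]_(k, d)) : Prop :=
  forall g, (S *m (rep g)^T <= S)%MS.

(* S is a nonzero invariant subspace with no proper nonzero invariant subspace *)
Definition irreducible_sub (R : realType) (G : topologicalType) d
  (rep : G -> 'M[R[i]]_d) k (S : 'M[R[i]]_(k, d)) : Prop :=
  [/\ S != 0, invariant_sub rep S &
      forall U : 'M[R[i]]_d, (U <= S)%MS -> invariant_sub rep U ->
        (U == 0) \/ (S <= U)%MS].

(* an irrep of G (continuous, unitary, irreducible) *)
Definition irrep (R : realType) (G : topologicalType) (gr : cgroup G) d
  (lam : G -> 'M[R[i]]_d) : Prop :=
  unitary_rep gr lam /\ irreducible_sub lam (1%:M : 'M[R[i]]_d).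

(* closed abelian subgroup H of G, given as a set *)
Definition closed_abelian_subgroup (G : topologicalType) (gr : cgroup G)
  (Hs : set G) : Prop :=
  [/\ Hs (gone gr), (forall x y, Hs x -> Hs y -> Hs (gmul gr x y)),
      (forall x, Hs x -> Hs (ginv gr x)),
      (forall x y, Hs x -> Hs y -> gmul gr x y = gmul gr y x)
    & closed Hs].

(* dH = dim (V^lam)^H, the dimension of the H-fixed subspace *)
Definition fixdim (R : realType) (G : topologicalType) d
  (lam : G -> 'M[R[i]]_d) (Hs : set G) (dH : nat) : Prop :=
  exists B : 'M[R[i]]_d,
    (forall v : 'rV[R[i]]_d,
        (v <= B)%MS <-> (forall h, Hs h -> lam h *m v^T = v^T))
    /\ \rank B = dH.

(* NDCSE: the basis W is the set of columns w_k = col k U of U; blk    *)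
(* assigns each basis vector to a block (eta,i); the blocks span the    *)
(* irreducible G-submodules H^{eta,i}.                                  *)

Definition wvec (R : realType) n (U : 'M[R[i]]_n) (k : 'I_n) : 'cV[R[i]]_n :=
  col k U.

Definition blockspace (R : realType) n m (U : 'M[R[i]]_n) (blk : 'I_n -> 'I_m)
  (b : 'I_m) : 'M[R[i]]_n :=
  \matrix_(k < n) (if blk k == b then (wvec U k)^T else 0).

Definition NDCSE (R : realType) (G : topologicalType) (gr : cgroup G) n
  (Rrep : G -> 'M[R[i]]_n) (Hs : set G) m (U : 'M[R[i]]_n)
  (blk : 'I_n -> 'I_m) : Prop :=
  [/\ adj U *m U = 1%:M,                                   (* orthonormal basis *)
      forall b, irreducible_sub Rrep (blockspace U blk b), (* irreducible G-submodules *)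
      forall h k, Hs h -> exists c, Rrep h *m wvec U k = c *: wvec U k
                                                   (* simultaneous eigenvectors of R(H) *)
    & forall k k', k != k' -> blk k = blk k' ->
        exists h, Hs h /\ braket (wvec U k) (Rrep h) (wvec U k)
                          != braket (wvec U k') (Rrep h) (wvec U k')
                                    (* each H^{eta,i} is multiplicity-free under H *)
  ].

(* L^D = (+) End(H^{eta,i}) : block-diagonal operators *)
Definition in_LD (R : realType) n m (U : 'M[R[i]]_n) (blk : 'I_n -> 'I_m)
  (X : 'M[R[i]]_n) : Prop :=
  forall k k', blk k != blk k' -> braket (wvec U k) X (wvec U k') = 0.

(* A_W(X) = sum_w <w|X|w> |w><w| *)
Definition AW (R : realType) n (U : 'M[R[i]]_n) (X : 'M[R[i]]_n) : 'M[R[i]]_n :=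
  \sum_k braket (wvec U k) X (wvec U k) *: (wvec U k *m adj (wvec U k)).

(* M_W(X) = int_G R(g)^dag A_W(R(g) X R(g)^dag) R(g) dg *)
Definition MW (R : realType) (G : topologicalType) (I : (G -> R) -> R) n
  (Rrep : G -> 'M[R[i]]_n) (U : 'M[R[i]]_n) (X : 'M[R[i]]_n) : 'M[R[i]]_n :=
  cintmx I (fun g => adj (Rrep g) *m AW U (Rrep g *m X *m adj (Rrep g)) *m Rrep g).

(* matrix of M_W acting on vectorized operators (row convention, mxvec);
   the HS inner product is the standard inner product of mxvec's. *)
Definition MWmat (R : realType) (G : topologicalType) (I : (G -> R) -> R) n
  (Rrep : G -> 'M[R[i]]_n) (U : 'M[R[i]]_n) : 'M[R[i]]_(n * n) :=
  lin_mx (MW I Rrep U).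

(* the linear map on L with matrix P *)
Definition apply_mat (R : realType) n (P : 'M[R[i]]_(n * n)) (X : 'M[R[i]]_n)
  : 'M[R[i]]_n := vec_mx (mxvec X *m P).

(* outcome probability p(w|g) = <w| R(g) rho R(g)^dag |w> *)
Definition outprob (R : realType) (G : topologicalType) n (Rrep : G -> 'M[R[i]]_n)
  (U : 'M[R[i]]_n) (rho : 'M[R[i]]_n) (g : G) (k : 'I_n) : R :=
  reC (braket (wvec U k) (Rrep g *m rho *m adj (Rrep g)) (wvec U k)).

(* single-shot estimate  o^ = Tr[ O M_W^+( R(g)^dag |w><w| R(g) ) ]  (real) *)
Definition ohat (R : realType) (G : topologicalType) n (Rrep : G -> 'M[R[i]]_n)
  (U : 'M[R[i]]_n) (Pinv : 'M[R[i]]_(n * n)) (O : 'M[R[i]]_n) (g : G) (k : 'I_n)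
  : R :=
  reC (\tr (O *m apply_mat Pinv
                 (adj (Rrep g) *m (wvec U k *m adj (wvec U k)) *m Rrep g))).

(* expectation over g ~ Haar and outcome w ~ p(w|g) *)
Definition est_expect (R : realType) (G : topologicalType) (I : (G -> R) -> R) n
  (Rrep : G -> 'M[R[i]]_n) (U : 'M[R[i]]_n) (rho : 'M[R[i]]_n)
  (f : G -> 'I_n -> R) : R :=
  I (fun g => \sum_k outprob Rrep U rho g k * f g k).

Definition est_variance (R : realType) (G : topologicalType) (I : (G -> R) -> R) n
  (Rrep : G -> 'M[R[i]]_n) (U : 'M[R[i]]_n) (rho : 'M[R[i]]_n)
  (f : G -> 'I_n -> R) : R :=
  est_expect I Rrep U rho (fun g k => f g k ^+ 2) - (est_expect I Rrep U rho f) ^+ 2.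

(* Intertwiners V^lam -> L and the lam-isotypic component of L^D.      *)
(* A linear map Phi : C^d -> L is given by the images Phi a of the     *)
(* standard basis vectors e_a.                                         *)

Definition intertwiner (R : realType) (G : topologicalType) n d
  (Rrep : G -> 'M[R[i]]_n) (lam : G -> 'M[R[i]]_d) (Phi : 'I_d -> 'M[R[i]]_n)
  : Prop :=
  forall g a, Rrep g *m Phi a *m adj (Rrep g) = \sum_b lam g b a *: Phi b.

Definition lin_indep (R : realType) n d (Phi : 'I_d -> 'M[R[i]]_n) : Prop :=
  forall c : 'I_d -> R[i], \sum_a c a *: Phi a = 0 -> forall a, c a = 0.

Definition in_span (R : realType) n d (F : 'I_d -> 'M[R[i]]_n) (X : 'M[R[i]]_n)
  : Prop := exists c : 'I_d -> R[i], X = \sum_a c a *: F a.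

(* X lies in the lam-isotypic component of L^D: X is a sum of elements of
   G-submodules of L^D isomorphic to lam (images of injective intertwiners). *)
Definition in_isotypic (R : realType) (G : topologicalType) n m d
  (Rrep : G -> 'M[R[i]]_n) (U : 'M[R[i]]_n) (blk : 'I_n -> 'I_m)
  (lam : G -> 'M[R[i]]_d) (X : 'M[R[i]]_n) : Prop :=
  exists (p : nat) (Phi : 'I_p -> 'I_d -> 'M[R[i]]_n),
    (forall j, [/\ intertwiner Rrep lam (Phi j), lin_indep (Phi j)
                 & forall a, in_LD U blk (Phi j a)])
    /\ exists x : 'I_p -> 'I_d -> R[i], X = \sum_j \sum_a x j a *: Phi j a.

(* Condition (ii) of the theorem. *)
Definition cond_ii (R : realType) (G : topologicalType) n m d
  (Rrep : G -> 'M[R[i]]_n) (U : 'M[R[i]]_n) (blk : 'I_n -> 'I_m)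
  (lam : G -> 'M[R[i]]_d) (O : 'M[R[i]]_n) : Prop :=
  exists (b : 'I_m) (Ob : 'I_d -> 'M[R[i]]_n),
    [/\ (* E = span{O_beta} is contained in End(H^{b}) *)
        (forall beta k k', braket (wvec U k) (Ob beta) (wvec U k') != 0 ->
                          blk k = b /\ blk k' = b)
        (* E is a G-submodule isomorphic to lam *)
        /\ (exists Phi : 'I_d -> 'M[R[i]]_n,
          [/\ intertwiner Rrep lam Phi, lin_indep Phi,
              (forall a, in_span Ob (Phi a)) & (forall beta, in_span Phi (Ob beta))]),
        (* {O_beta} is a Hilbert--Schmidt orthonormal family of Hermitian operators *)
        (forall beta beta', \tr (adj (Ob beta) *m Ob beta') = (beta == beta')%:R)
          /\ (forall beta, is_hermitian (Ob beta))
          /\ (forall beta beta', opnorm (Ob beta) = opnorm (Ob beta')),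
        (* the set {O_beta} is closed under the G-action *)
        (forall g beta, exists beta', Rrep g *m Ob beta *m adj (Rrep g) = Ob beta')
        (* each O_beta is diagonal in W or has vanishing diagonal *)
        /\ (forall beta,
          (forall k k', k != k' -> braket (wvec U k) (Ob beta) (wvec U k') = 0)
          \/ (forall k, braket (wvec U k) (Ob beta) (wvec U k) = 0))
      & (* O is one of the O_beta *)
        exists beta0, O = Ob beta0].

(* Main.v *)
From HB Require Import structures.
Require Import Defs.
From mathcomp Require Import all_boot all_order all_algebra.
From mathcomp Require Import complex.
From mathcomp Require Import all_classical all_reals all_analysis.
From mathcomp Require Import spectral ring lra.
Import Order.TTheory GRing.Theory Num.Theory.
Import numFieldNormedType.Exports.
Local Open Scope ring_scope.

(** On an intertwiner [Phi] from an irrep [lam] into the block-diagonal operators,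
    dephasing in the basis [W] is [Phi \o Q] with [Q] the projection of [V^lam] onto
    its [H]-fixed vectors: since each block is multiplicity-free under [H], the
    diagonal operators are exactly the [H]-fixed ones.  Schur's lemma turns the
    Haar average of [lam^dag Q lam] into [a = tr Q / dim lam = a^H_lam], so the
    measurement channel acts as [a] on the [lam]-isotypic component and the
    estimate is [<w|R(g) O R(g)^dag|w> / a].  Its second moment is bounded using
    [q^2 <= ||O|| |q|] for semidefinite [O], and in the orbit case because [q]
    vanishes outside an event of probability [a]. *)

(** * Real and imaginary parts of complex numbers *)

Section Complex.
Set Implicit Arguments.
Unset Strict Implicit.
Variable R : realType.
Implicit Types x y : R[i].

Lemma reCD x y : reC (x + y) = reC x + reC y. Proof. by case: x y => ? ? []. Qed.
Lemma imCD x y : imC (x + y) = imC x + imC y. Proof. by case: x y => ? ? []. Qed.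
Lemma reCN x : reC (- x) = - reC x. Proof. by case: x. Qed.
Lemma reCM x y : reC (x * y) = reC x * reC y - imC x * imC y.
Proof. by case: x y => ? ? []. Qed.
Lemma imCM x y : imC (x * y) = reC x * imC y + imC x * reC y.
Proof. by case: x y => ? ? []. Qed.
Lemma reC_conj x : reC x^* = reC x. Proof. by case: x. Qed.
Lemma imC_conj x : imC x^* = - imC x. Proof. by case: x. Qed.

Lemma reC_sum (J : finType) (f : J -> R[i]) : reC (\sum_j f j) = \sum_j reC (f j).
Proof. by apply: (big_morph (@reC R)) => // x y; exact: reCD. Qed.

Lemma conj_imC0 x : x^* = x -> imC x = 0.
Proof. by move=> h; have := imC_conj x; rewrite h; lra. Qed.

Lemma conj_reC x : x^* = x -> x = (reC x)%:C%C.
Proof. by move/conj_imC0; case: x => a b /= ->. Qed.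

Lemma ge0_reC x : 0 <= x -> 0 <= reC x.
Proof. by case: x => a b; rewrite lecE /= => /andP[]. Qed.

Lemma complex_ext x y : reC x = reC y -> imC x = imC y -> x = y.
Proof. by case: x y => ? ? [? ?] /= -> ->. Qed.

End Complex.

(** * Adjoints, matrix entries in an orthonormal basis, and the Hilbert-Schmidt product *)

Section Adjoint.
Set Implicit Arguments.
Unset Strict Implicit.
Variable R : realType.

Lemma adjE m k (A : 'M[R[i]]_(m, k)) i j : adj A i j = (A j i)^*.
Proof. by rewrite !mxE. Qed.

Lemma adjM m k l (A : 'M[R[i]]_(m, k)) (B : 'M[R[i]]_(k, l)) :
  adj (A *m B) = adj B *m adj A.
Proof.
apply/matrixP => i j; rewrite adjE !mxE rmorph_sum; apply: eq_bigr => t _.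
by rewrite !adjE rmorphM mulrC.
Qed.

Lemma adjK m k (A : 'M[R[i]]_(m, k)) : adj (adj A) = A.
Proof. by apply/matrixP => i j; rewrite !adjE conjCK. Qed.

Lemma braketE n (A : 'M[R[i]]_n) (U : 'M[R[i]]_n) k l :
  braket (wvec U k) A (wvec U l) = (adj U *m A *m U) k l.
Proof.
rewrite /braket /wvec !mxE; apply: eq_bigr => i _; rewrite !mxE; congr (_ * _).
by apply: eq_bigr => j _; rewrite !mxE.
Qed.

Lemma mxtrace_outer n (A : 'M[R[i]]_n) (v : 'cV[R[i]]_n) :
  \tr (A *m (v *m adj v)) = braket v A v.
Proof. by rewrite mulmxA mxtrace_mulC mulmxA /mxtrace big_ord1. Qed.

Lemma braket_conj n (A : 'M[R[i]]_n) (v : 'cV[R[i]]_n) :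
  (braket v A v)^* = braket v (adj A) v.
Proof. by rewrite /braket -adjE !adjM adjK mulmxA. Qed.

Lemma braket_conjmx n (A V : 'M[R[i]]_n) (v : 'cV[R[i]]_n) :
  braket v (V *m A *m adj V) v = braket (adj V *m v) A (adj V *m v).
Proof. by rewrite /braket adjM adjK !mulmxA. Qed.

Lemma unitary_mulC n (V : 'M[R[i]]_n) : adj V *m V = 1%:M -> V *m adj V = 1%:M.
Proof. exact: mulmx1C. Qed.

(** Both sides sum conj(A i j) B i j. This carries trace identities over to the matrix [MWmat] of
    the channel on vectorised operators, where the pseudoinverse lives. *)
Lemma mxtrace_mxvec n (A B : 'M[R[i]]_n) :
  \tr (adj A *m B) = (mxvec B *m adj (mxvec A)) 0 0.
Proof.
rewrite !mxE (reindex _ (curry_mxvec_bij n n)) /=.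
rewrite /mxtrace (eq_bigr (fun i => \sum_j (A j i)^* * B j i)); last first.
  by move=> i _; rewrite mxE; apply: eq_bigr => j _; rewrite adjE.
rewrite exchange_big pair_bigA /=; apply: eq_bigr => -[i j] _ /=.
by rewrite mulrC adjE !mxvecE.
Qed.

Lemma vnorm2E n (v : 'cV[R[i]]_n) :
  vnorm2 v = \sum_i (reC (v i 0) ^+ 2 + imC (v i 0) ^+ 2).
Proof.
rewrite /vnorm2 mxE reC_sum; apply: eq_bigr => i _.
by rewrite adjE reCM reC_conj imC_conj; ring.
Qed.

Lemma vnorm2_ge0 n (v : 'cV[R[i]]_n) : 0 <= vnorm2 v.
Proof. by rewrite vnorm2E; apply: sumr_ge0 => i _; rewrite addr_ge0 ?sqr_ge0. Qed.

Lemma vnorm2_unitary n (V : 'M[R[i]]_n) (v : 'cV[R[i]]_n) :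
  adj V *m V = 1%:M -> vnorm2 (V *m v) = vnorm2 v.
Proof. by move=> hV; rewrite /vnorm2 adjM -mulmxA (mulmxA _ V) hV mul1mx. Qed.

Lemma vnorm2_wvec n (U : 'M[R[i]]_n) k : adj U *m U = 1%:M -> vnorm2 (wvec U k) = 1.
Proof.
move=> hU; rewrite /vnorm2.
have -> : (adj (wvec U k) *m wvec U k) 0 0 = (adj U *m U) k k.
  by rewrite !mxE; apply: eq_bigr => i _; rewrite !mxE.
by rewrite hU mxE eqxx.
Qed.

End Adjoint.

(** * Continuity, and Haar integrals of complex and matrix functions *)

Section Integral.
Set Implicit Arguments.
Unset Strict Implicit.
Variables (R : realType) (G : topologicalType).
Implicit Types f h : G -> R[i].

(** [cont_mx F] unfolds to this condition on every entry. Additivity, homogeneity, positivity and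
    invariance in [haar_integral] concern continuous functions, so each use of them needs a
    continuity proof. *)
Definition ccont f :=
  continuous (fun g => reC (f g)) /\ continuous (fun g => imC (f g)).

Lemma continuousDf (f h : G -> R) : continuous f -> continuous h ->
  continuous (fun g => f g + h g).
Proof. by move=> cf ch g; apply: cvgD; [exact: cf|exact: ch]. Qed.

Lemma continuousMf (f h : G -> R) : continuous f -> continuous h ->
  continuous (fun g => f g * h g).
Proof. by move=> cf ch g; apply: cvgM; [exact: cf|exact: ch]. Qed.

Lemma continuousNf (f : G -> R) : continuous f -> continuous (fun g => - f g).
Proof. by move=> cf g; apply: cvgN; exact: cf. Qed.

Lemma continuous_sumf (J : finType) (f : J -> G -> R) :
  (forall j, continuous (f j)) -> continuous (fun g => \sum_j f j g).
Proof.
move=> cf; rewrite (_ : (fun g => _) = \sum_j f j); last first.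
  by apply/funext => g; rewrite fct_sumE.
by elim/big_ind: _ => // [|u v cu cv]; [exact: cst_continuous|exact: continuousDf].
Qed.

Lemma ccont_cst c : ccont (fun=> c).
Proof. by split; exact: cst_continuous. Qed.

Lemma ccontD f h : ccont f -> ccont h -> ccont (fun g => f g + h g).
Proof.
move=> [f1 f2] [h1 h2]; split.
- by under eq_fun do rewrite reCD; exact: continuousDf.
- by under eq_fun do rewrite imCD; exact: continuousDf.
Qed.

Lemma ccontM f h : ccont f -> ccont h -> ccont (fun g => f g * h g).
Proof.
move=> [f1 f2] [h1 h2]; split.
- under eq_fun do rewrite reCM.
  by apply: continuousDf; [|apply: continuousNf]; exact: continuousMf.
- by under eq_fun do rewrite imCM; apply: continuousDf; exact: continuousMf.
Qed.

Lemma ccont_conj f : ccont f -> ccont (fun g => (f g)^*).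
Proof.
move=> [f1 f2]; split; first by under eq_fun do rewrite reC_conj.
by under eq_fun do rewrite imC_conj; exact: continuousNf.
Qed.

Lemma ccont_sum (J : finType) (f : J -> G -> R[i]) :
  (forall j, ccont (f j)) -> ccont (fun g => \sum_j f j g).
Proof.
move=> cf; rewrite (_ : (fun g => _) = \sum_j f j); last first.
  by apply/funext => g; rewrite fct_sumE.
by elim/big_ind: _ => // [|u v cu cv]; [exact: ccont_cst|exact: ccontD].
Qed.

Lemma cont_mx_cst m k (A : 'M[R[i]]_(m, k)) : cont_mx (fun _ : G => A).
Proof. by move=> i j; exact: ccont_cst. Qed.

Lemma cont_mx_mul m k l (F : G -> 'M[R[i]]_(m, k)) (H : G -> 'M[R[i]]_(k, l)) :
  cont_mx F -> cont_mx H -> cont_mx (fun g => F g *m H g).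
Proof.
move=> cF cH i j; change (ccont (fun g => (F g *m H g) i j)).
under eq_fun do rewrite mxE.
by apply: ccont_sum => t; apply: ccontM; [exact: cF|exact: cH].
Qed.

Lemma cont_mx_adj m k (F : G -> 'M[R[i]]_(m, k)) :
  cont_mx F -> cont_mx (fun g => adj (F g)).
Proof.
move=> cF i j; change (ccont (fun g => adj (F g) i j)).
by under eq_fun do rewrite adjE; apply: ccont_conj; exact: cF.
Qed.

Lemma cont_mx_scale m k (c : G -> R[i]) (F : G -> 'M[R[i]]_(m, k)) :
  ccont c -> cont_mx F -> cont_mx (fun g => c g *: F g).
Proof.
move=> cc cF i j; change (ccont (fun g => (c g *: F g) i j)).
by under eq_fun do rewrite mxE; apply: ccontM; [|exact: cF].
Qed.

Lemma cont_mx_sum (J : finType) m k (F : J -> G -> 'M[R[i]]_(m, k)) :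
  (forall t, cont_mx (F t)) -> cont_mx (fun g => \sum_t F t g).
Proof.
move=> cF i j; change (ccont (fun g => (\sum_t F t g) i j)).
by under eq_fun do rewrite summxE; apply: ccont_sum => t; exact: cF.
Qed.

Lemma ccont_braket n (F : G -> 'M[R[i]]_n) v :
  cont_mx F -> ccont (fun g => braket v (F g) v).
Proof.
move=> cF; rewrite /braket; have h : cont_mx (fun g => adj v *m F g *m v).
  by do 2 (apply: cont_mx_mul; try exact: cont_mx_cst).
exact: h.
Qed.

Lemma cont_mx_conj n (V : G -> 'M[R[i]]_n) X :
  cont_mx V -> cont_mx (fun g => V g *m X *m adj (V g)).
Proof.
move=> cV; apply: cont_mx_mul; last exact: cont_mx_adj.
by apply: cont_mx_mul => //; exact: cont_mx_cst.
Qed.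

Lemma cont_mx_conjV n (V : G -> 'M[R[i]]_n) X :
  cont_mx V -> cont_mx (fun g => adj (V g) *m X *m V g).
Proof.
move=> cV; apply: cont_mx_mul => //.
by apply: cont_mx_mul; [exact: cont_mx_adj|exact: cont_mx_cst].
Qed.

Variables (gr : cgroup G) (I : (G -> R) -> R).
Hypothesis HI : haar_integral gr I.

Lemma haarN (f : G -> R) : continuous f -> I (fun g => - f g) = - I f.
Proof.
case: HI => _ hZ _ _ _ cf; under eq_fun do rewrite -mulN1r.
by rewrite hZ // mulN1r.
Qed.

Lemma haar_le (f h : G -> R) : continuous f -> continuous h ->
  (forall g, f g <= h g) -> I f <= I h.
Proof.
move=> cf ch le; case: (HI) => hD _ hpos _ _; rewrite -subr_ge0.
rewrite -haarN // -hD //; last exact: continuousNf.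
apply: hpos => [|g]; last by rewrite subr_ge0.
by apply: continuousDf => //; exact: continuousNf.
Qed.

Lemma cintD f h : ccont f -> ccont h ->
  cint I (fun g => f g + h g) = cint I f + cint I h.
Proof.
move=> [f1 f2] [h1 h2]; case: (HI) => hD _ _ _ _.
apply: complex_ext; rewrite ?reCD ?imCD /=.
- by under eq_fun do rewrite reCD; rewrite hD.
- by under eq_fun do rewrite imCD; rewrite hD.
Qed.

Lemma cintZ c f : ccont f -> cint I (fun g => c * f g) = c * cint I f.
Proof.
move=> [f1 f2]; case: (HI) => hD hZ _ _ _.
have cZ (t : R) (u : G -> R) : continuous u -> continuous (fun g => t * u g).
  by move=> cu; apply: (@continuousMf (fun=> t)) => //; exact: cst_continuous.
apply: complex_ext; rewrite ?reCM ?imCM /=.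
- under eq_fun do rewrite reCM.
  have [k1 k2] := (cZ (reC c) _ f1, cZ (imC c) _ f2).
  by rewrite hD //; [rewrite haarN // !hZ|exact: continuousNf].
- under eq_fun do rewrite imCM.
  have [k1 k2] := (cZ (reC c) _ f2, cZ (imC c) _ f1).
  by rewrite hD // !hZ.
Qed.

Lemma cint_cst c : cint I (fun=> c) = c.
Proof.
case: (HI) => _ hZ _ h1 _.
have hc (t : R) : I (fun=> t) = t.
  rewrite -[RHS]mulr1 -h1 -hZ; last exact: cst_continuous.
  by congr I; apply/funext => g; rewrite mulr1.
by apply: complex_ext => /=; rewrite hc.
Qed.

Lemma cint_sum (J : finType) (f : J -> G -> R[i]) : (forall j, ccont (f j)) ->
  cint I (fun g => \sum_j f j g) = \sum_j cint I (f j).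
Proof.
(* Continuity of the partial sums travels with the induction, since [cintD] asks for it at each
   step. *)
move=> cf; suff: ccont (fun g => \sum_j f j g) /\
   cint I (fun g => \sum_j f j g) = \sum_j cint I (f j) by case.
have e (r : seq J) : (fun g => \sum_(j <- r) f j g) = \sum_(j <- r) f j.
  by apply/funext => g; rewrite fct_sumE.
rewrite e; elim/big_ind2: _ => //=.
- by split; [exact: ccont_cst|exact: cint_cst].
- by move=> u x v y [cu <-] [cv <-]; split; [exact: ccontD|exact: cintD].
Qed.

Lemma cint_transl f s : ccont f -> cint I (fun g => f (gmul gr s g)) = cint I f.
Proof.
move=> [f1 f2]; case: (HI) => _ _ _ _ hs.
apply: complex_ext => /=.
- exact: (hs (fun g => reC (f g))).
- exact: (hs (fun g => imC (f g))).
Qed.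

Lemma cintmx_mull m k l (A : 'M[R[i]]_(m, k)) (F : G -> 'M[R[i]]_(k, l)) :
  cont_mx F -> cintmx I (fun g => A *m F g) = A *m cintmx I F.
Proof.
move=> cF; apply/matrixP => i j; rewrite !mxE; under eq_fun do rewrite mxE.
rewrite cint_sum => [|t]; last by apply: ccontM; [exact: ccont_cst|exact: cF].
by apply: eq_bigr => t _; rewrite mxE cintZ //; exact: cF.
Qed.

Lemma cintmx_mulr m k l (F : G -> 'M[R[i]]_(m, k)) (A : 'M[R[i]]_(k, l)) :
  cont_mx F -> cintmx I (fun g => F g *m A) = cintmx I F *m A.
Proof.
move=> cF; apply/matrixP => i j; rewrite !mxE; under eq_fun do rewrite mxE.
rewrite cint_sum => [|t]; last by apply: ccontM; [exact: cF|exact: ccont_cst].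
apply: eq_bigr => t _; rewrite mxE mulrC -cintZ; last exact: cF.
by under eq_fun do rewrite mulrC.
Qed.

Lemma cintmx_tr n (F : G -> 'M[R[i]]_n) :
  cont_mx F -> \tr (cintmx I F) = cint I (fun g => \tr (F g)).
Proof.
move=> cF; rewrite cint_sum; last by move=> j; exact: cF.
by apply: eq_bigr => i _; rewrite mxE.
Qed.

Lemma cintmxD m k (F H : G -> 'M[R[i]]_(m, k)) : cont_mx F -> cont_mx H ->
  cintmx I (fun g => F g + H g) = cintmx I F + cintmx I H.
Proof.
move=> cF cH; apply/matrixP => i j; rewrite !mxE; under eq_fun do rewrite mxE.
by rewrite cintD.
Qed.

Lemma cintmxZ m k c (F : G -> 'M[R[i]]_(m, k)) : cont_mx F ->
  cintmx I (fun g => c *: F g) = c *: cintmx I F.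
Proof.
move=> cF; apply/matrixP => i j; rewrite !mxE; under eq_fun do rewrite mxE.
by rewrite cintZ //; exact: cF.
Qed.

Lemma cintmx_transl m k (F : G -> 'M[R[i]]_(m, k)) s : cont_mx F ->
  cintmx I (fun g => F (gmul gr s g)) = cintmx I F.
Proof.
move=> cF; apply/matrixP => i j; rewrite !mxE.
by rewrite (@cint_transl (fun g => F g i j)) //; exact: cF.
Qed.

End Integral.

(** * Schur's lemma and Haar averages over an irrep *)

Section Schur.
Set Implicit Arguments.
Unset Strict Implicit.
Variables (R : realType) (G : topologicalType) (gr : cgroup G).
Variables (d : nat) (lam : G -> 'M[R[i]]_d).
Hypotheses (d_gt0 : (0 < d)%N) (Hlam : irrep gr lam).

(** [R[i]] is algebraically closed, so [A^T] has an eigenvalue; its eigenspace is invariant because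
    [A] commutes with [lam], hence is everything. The transpose matches the convention that
    subspaces are row spaces. *)
Lemma schur (A : 'M[R[i]]_d) :
  (forall g, lam g *m A = A *m lam g) -> exists c, A = c%:M.
Proof.
move=> comm; have /closed_rootP[c] : size (char_poly A^T) != 1%N.
  by rewrite size_char_poly; case: (d) d_gt0.
rewrite -eigenvalue_root_char => ev; exists c.
case: Hlam => _ [_ _ irr]; have [|g|/eqP e0|] := irr (eigenspace A^T c).
- exact: submx1.
- apply/eigenspaceP; rewrite -mulmxA -trmx_mul -comm trmx_mul mulmxA.
  have /eigenspaceP e := submx_refl (eigenspace A^T c).
  by rewrite e -scalemxAl.
- by move: ev; rewrite /eigenvalue e0 eqxx.
- move=> /eigenspaceP; rewrite mul1mx => h.
  by rewrite -[A]trmxK h linearZ /= trmx1 scalemx1.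
Qed.

Variable I : (G -> R) -> R.
Hypothesis HI : haar_integral gr I.

(** Left invariance makes the average commute with every [lam g], so it is scalar by [schur];
    conjugation preserves the trace, which fixes the scalar. *)
Lemma twirl_scalar (B : 'M[R[i]]_d) :
  cintmx I (fun g => lam g *m B *m adj (lam g)) = (\tr B / d%:R)%:M.
Proof.
case: (Hlam) => -[lamM lamU lamC] _.
set K := cintmx _ _; have cK := cont_mx_conj B lamC.
have dneq0 : d%:R != 0 :> R[i] by rewrite pnatr_eq0 -lt0n.
have [g|c Kc] := @schur K.
  have KE : lam g *m K *m adj (lam g) = K.
    rewrite -(cintmx_mull HI) // -(cintmx_mulr HI); last first.
      by apply: cont_mx_mul => //; exact: cont_mx_cst.
    rewrite -[RHS](cintmx_transl HI g) //; congr cintmx; apply/funext => x.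
    by rewrite lamM adjM !mulmxA.
  by rewrite -{2}KE -!mulmxA lamU mulmx1.
have trK : \tr K = \tr B.
  rewrite (cintmx_tr HI) //.
  under eq_fun do rewrite mxtrace_mulC mulmxA lamU mul1mx.
  exact: (cint_cst HI).
by rewrite Kc -trK Kc mxtrace_scalar -[c *+ d]mulr_natr mulfK.
Qed.

(** Pairing with a matrix unit lets matrix identities be checked under the trace. *)
Lemma mxtrace_delta n (A : 'M[R[i]]_n) i j : \tr (A *m delta_mx j i) = A i j.
Proof.
rewrite /mxtrace (bigD1 i) //= big1 => [|k ki]; rewrite mxE (bigD1 j) //= big1.
- by rewrite mxE !eqxx mulr1 !addr0.
- by move=> k kj; rewrite mxE (negbTE kj) mulr0.
- by rewrite mxE (negbTE ki) andbF mulr0 addr0.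
- by move=> l lj; rewrite mxE (negbTE lj) mulr0.
Qed.

(* Pairing with an arbitrary [B] moves the twirl from [Q] to [B], where left
   invariance applies. *)
Lemma dual_twirl_scalar (Q : 'M[R[i]]_d) :
  cintmx I (fun g => adj (lam g) *m Q *m lam g) = (\tr Q / d%:R)%:M.
Proof.
case: (Hlam) => -[_ _ lamC] _.
have cK := cont_mx_conjV Q lamC.
apply/matrixP => i j; rewrite -mxtrace_delta -(cintmx_mulr HI) //.
rewrite (cintmx_tr HI); last by apply: cont_mx_mul => //; exact: cont_mx_cst.
under eq_fun do rewrite -2!mulmxA mxtrace_mulC -mulmxA.
rewrite -(cintmx_tr HI); last first.
  by apply: cont_mx_mul; [exact: cont_mx_cst|exact: cont_mx_conj].
rewrite (cintmx_mull HI); last exact: cont_mx_conj.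
rewrite twirl_scalar -mxtrace_delta scalar_mxC !mul_scalar_mx !mxtraceZ.
rewrite -[delta_mx j i]mul1mx mxtrace_delta; ring.
Qed.

End Schur.

(** Write Q = C B with C = [col_base Q] and B = [row_base Q]. Then C (B C) B = Q^2 = C B; cancelling
    C on the left and B on the right shows that B C is the identity of size the rank, and its trace
    is that of Q. *)
Lemma mxtrace_idempotent (F : fieldType) n (Q : 'M[F]_n) :
  Q *m Q = Q -> \tr Q = (\rank Q)%:R.
Proof.
move=> QQ; rewrite -{1}[Q]mulmx_base mxtrace_mulC.
suff -> : row_base Q *m col_base Q = 1%:M by rewrite mxtrace1.
apply: (row_free_inj (row_base_free Q)); apply: (row_full_inj (col_base_full Q)).
by rewrite mul1mx mulmx_base -mulmxA mulmx_base mulmxA mulmx_base QQ.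
Qed.

(** * The measurement channel: linearity and symmetry under the trace *)

Section Channel.
Set Implicit Arguments.
Unset Strict Implicit.
Variables (R : realType) (G : topologicalType) (gr : cgroup G).
Variables (I : (G -> R) -> R) (HI : haar_integral gr I).
Variables (n : nat) (Rrep : G -> 'M[R[i]]_n) (HR : unitary_rep gr Rrep).
Variable U : 'M[R[i]]_n.

Lemma AWD X Y : AW U (X + Y) = AW U X + AW U Y.
Proof.
rewrite /AW -big_split; apply: eq_bigr => k _ /=.
by rewrite /braket mulmxDr mulmxDl mxE scalerDl.
Qed.

Lemma AWZ c X : AW U (c *: X) = c *: AW U X.
Proof.
rewrite /AW scaler_sumr; apply: eq_bigr => k _.
by rewrite /braket -scalemxAr -scalemxAl mxE scalerA.
Qed.

Lemma cont_mx_AW (F : G -> 'M[R[i]]_n) : cont_mx F -> cont_mx (fun g => AW U (F g)).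
Proof.
move=> cF; apply: cont_mx_sum => k; apply: cont_mx_scale; last exact: cont_mx_cst.
exact: ccont_braket.
Qed.

Lemma cont_mx_MW X : cont_mx (fun g =>
  adj (Rrep g) *m AW U (Rrep g *m X *m adj (Rrep g)) *m Rrep g).
Proof.
case: HR => _ _ cR; apply: cont_mx_mul => //; apply: cont_mx_mul.
  exact: cont_mx_adj.
by apply: cont_mx_AW; exact: cont_mx_conj.
Qed.

Lemma MWD X Y : MW I Rrep U (X + Y) = MW I Rrep U X + MW I Rrep U Y.
Proof.
rewrite /MW -(cintmxD HI); try exact: cont_mx_MW.
congr cintmx; apply/funext => g.
by rewrite mulmxDr mulmxDl AWD mulmxDr mulmxDl.
Qed.

Lemma MWZ c X : MW I Rrep U (c *: X) = c *: MW I Rrep U X.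
Proof.
rewrite /MW -(cintmxZ HI); last exact: cont_mx_MW.
congr cintmx; apply/funext => g.
by rewrite -!scalemxAr -scalemxAl AWZ -scalemxAr -scalemxAl.
Qed.

Lemma MW_sum (J : finType) (F : J -> 'M[R[i]]_n) :
  MW I Rrep U (\sum_j F j) = \sum_j MW I Rrep U (F j).
Proof.
apply: (big_morph (MW I Rrep U) MWD).
by have := MWZ 0 0; rewrite !scale0r.
Qed.

Lemma mxtrace_AW X Y : \tr (Y *m AW U X) =
  \sum_k braket (wvec U k) Y (wvec U k) * braket (wvec U k) X (wvec U k).
Proof.
rewrite /AW mulmx_sumr raddf_sum /=; apply: eq_bigr => k _.
by rewrite -scalemxAr mxtraceZ mxtrace_outer mulrC.
Qed.

(** Cyclicity moves the outer conjugation onto [Y], leaving an expression symmetric in [X] and [Y].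
    It yields the symmetry of the channel and turns averages of products of diagonals into
    traces. *)
Lemma mxtrace_MW X Y : \tr (Y *m MW I Rrep U X) = cint I (fun g => \sum_k
  braket (wvec U k) (Rrep g *m Y *m adj (Rrep g)) (wvec U k) *
  braket (wvec U k) (Rrep g *m X *m adj (Rrep g)) (wvec U k)).
Proof.
rewrite /MW -(cintmx_mull HI); last exact: cont_mx_MW.
rewrite (cintmx_tr HI); last first.
  by apply: cont_mx_mul; [exact: cont_mx_cst|exact: cont_mx_MW].
congr cint; apply/funext => g; rewrite -mxtrace_AW.
by rewrite mulmxA mxtrace_mulC !mulmxA.
Qed.

Lemma mxtrace_MWC X Y : \tr (Y *m MW I Rrep U X) = \tr (X *m MW I Rrep U Y).
Proof.
apply: etrans (mxtrace_MW X Y) (etrans _ (esym (mxtrace_MW Y X))).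
congr cint; apply/funext => g.
by apply: eq_bigr => k _; rewrite mulrC.
Qed.

Lemma mul_rV_MWmat X : mxvec X *m MWmat I Rrep U = mxvec (MW I Rrep U X).
Proof.
have lin : linear (MW I Rrep U) by move=> c x y; rewrite MWD MWZ.
(* Linearity of [MW I Rrep U] rests on [HI] and [HR], so the linear structure behind [lin_mx] is
   packed locally. *)
pose lf := GRing.isLinear.Build _ _ _ _ (MW I Rrep U) lin.
pose f : {linear 'M[R[i]]_n -> 'M[R[i]]_n} := HB.pack (MW I Rrep U) lf.
by rewrite (mul_rV_lin f) mxvecK.
Qed.

End Channel.

(** * Dephasing on the image of an intertwiner *)

Section Isotypic.
Set Implicit Arguments.
Unset Strict Implicit.
Variables (R : realType) (G : topologicalType) (gr : cgroup G).
Variables (I : (G -> R) -> R) (HI : haar_integral gr I).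
Variables (n : nat) (Rrep : G -> 'M[R[i]]_n) (HR : unitary_rep gr Rrep).
Variables (Hs : set G) (m : nat) (U : 'M[R[i]]_n) (blk : 'I_n -> 'I_m).
Hypothesis HW : NDCSE gr Rrep Hs U blk.
Local Notation ent X k l := (braket (wvec U k) X (wvec U l)).

Let UU : adj U *m U = 1%:M. Proof. by case: HW. Qed.

Lemma ent_inj X Y : (forall k l, ent X k l = ent Y k l) -> X = Y.
Proof.
move=> h; have : adj U *m X *m U = adj U *m Y *m U.
  by apply/matrixP => k l; rewrite -!braketE.
move=> /(congr1 (fun Z => U *m Z *m adj U)).
by rewrite !mulmxA (unitary_mulC UU) !mul1mx -!mulmxA (unitary_mulC UU) !mulmx1.
Qed.

Lemma wvec_orthonormal i j : (adj (wvec U i) *m wvec U j) 0 0 = (i == j)%:R.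
Proof.
transitivity ((adj U *m U) i j); last by rewrite UU mxE.
by rewrite !mxE; apply: eq_bigr => t _; rewrite !mxE.
Qed.

Lemma ent_AW X k l : ent (AW U X) k l = ent X k l *+ (k == l).
Proof.
rewrite {1}/braket /AW mulmx_sumr mulmx_suml summxE (bigD1 k) //= big1 => [|t tk].
  rewrite addr0 -scalemxAr -scalemxAl mxE !mulmxA -[_ *m _ *m _ *m _]mulmxA.
  rewrite mxE big_ord1 !wvec_orthonormal eqxx mul1r.
  by case: eqP => [->|]; rewrite ?mulr1 ?mulr0.
rewrite -scalemxAr -scalemxAl mxE !mulmxA -[_ *m _ *m _ *m _]mulmxA.
by rewrite mxE big_ord1 !wvec_orthonormal eq_sym (negbTE tk) mul0r mulr0.
Qed.

(** Basis vectors are eigenvectors of [Rrep h], so [Rrep h] is diagonal in [W], and the matrix unit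
    |w_k><w_l| has weight [chi k * (chi l)^*] under conjugation. *)
Lemma ent_weight h : Hs h -> let chi k := ent (Rrep h) k k in
  (forall k, chi k * (chi k)^* = 1) /\
  forall X k l, ent (Rrep h *m X *m adj (Rrep h)) k l =
    chi k * (chi l)^* * ent X k l.
Proof.
move=> Hh chi; pose D := diag_mx (\row_k chi k).
have [_ _ eigW _] := HW; case: HR => _ RU _.
have RE : Rrep h *m U = U *m D.
  suff h0 : adj U *m (Rrep h *m U) = D.
    by rewrite -h0 mulmxA (unitary_mulC UU) mul1mx.
  rewrite mulmxA; apply/matrixP => k l; rewrite -braketE /D !mxE.
  case: eqP => [->|/eqP kl]; first by rewrite mulr1n.
  have [c ew] := eigW h l Hh; rewrite /braket -mulmxA ew -scalemxAr mxE.
  by rewrite wvec_orthonormal (negbTE kl) mulr0 mulr0n.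
have RE' : adj U *m Rrep h = D *m adj U.
  by rewrite -[LHS]mulmx1 -(unitary_mulC UU) mulmxA -(mulmxA (adj U)) RE mulmxA UU
     mul1mx.
have RE2 : adj (Rrep h) *m U = U *m adj D.
  by rewrite -[LHS]adjK adjM adjK RE' adjM adjK.
have key X : adj U *m (Rrep h *m X *m adj (Rrep h)) *m U =
    D *m (adj U *m X *m U) *m adj D.
  by rewrite !mulmxA RE' -!mulmxA RE2 !mulmxA.
have ent' X k l : ent (Rrep h *m X *m adj (Rrep h)) k l =
    chi k * (chi l)^* * ent X k l.
  rewrite !braketE key /D mul_diag_mx mxE (bigD1 l) //= big1 => [|t tl].
    by rewrite addr0 !mxE eqxx mulr1n mulrAC.
  by rewrite adjE !mxE eq_sym (negbTE tl) mulr0n conjC0 mulr0.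
(* The weight formula at the identity operator, which conjugation fixes, gives |chi k| = 1. *)
split=> // k; have := ent' 1%:M k k; rewrite mulmx1 (unitary_mulC (RU h)).
by rewrite braketE mulmx1 UU mxE eqxx mulr1.
Qed.

(** Eigenvalues have modulus one, so weight 1 on (k, l) would make them equal. Multiplicity-freeness
    thus yields a nontrivial weight for each off-diagonal pair inside a block. *)
Lemma ent_weight_neq1 (h : G) k l : Hs h ->
  ent (Rrep h) k k != ent (Rrep h) l l ->
  ent (Rrep h) k k * (ent (Rrep h) l l)^* != 1.
Proof.
move=> Hh; apply: contra_neq => e; have [c1 _] := ent_weight Hh.
by rewrite -[LHS]mulr1 -(c1 l) mulrCA e mulr1.
Qed.

Variables (d : nat) (lam : G -> 'M[R[i]]_d).

(** The linear map from V^lam to operators that [Phi] gives on the standard basis; equivariance then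
    concerns [lam g *m v]. *)
Definition lift_mx (Phi : 'I_d -> 'M[R[i]]_n) (v : 'cV[R[i]]_d) : 'M[R[i]]_n :=
  \sum_a v a 0 *: Phi a.

Lemma lift_mxD Phi u v : lift_mx Phi (u + v) = lift_mx Phi u + lift_mx Phi v.
Proof.
by rewrite /lift_mx -big_split; apply: eq_bigr => a _; rewrite mxE scalerDl.
Qed.

Lemma lift_mxZ Phi c v : lift_mx Phi (c *: v) = c *: lift_mx Phi v.
Proof.
by rewrite /lift_mx scaler_sumr; apply: eq_bigr => a _; rewrite mxE scalerA.
Qed.

Lemma lift_mx_inj Phi : lin_indep Phi -> injective (lift_mx Phi).
Proof.
move=> li u v e; apply/matrixP => a j; rewrite ord1; apply/eqP; rewrite -subr_eq0.
apply/eqP; apply: (li (fun a => u a 0 - v a 0)).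
transitivity (lift_mx Phi u - lift_mx Phi v); last by rewrite e subrr.
rewrite /lift_mx -sumrB; apply: eq_bigr => b _; exact: scalerBl.
Qed.

Lemma lift_mx_intertwiner Phi g v : intertwiner Rrep lam Phi ->
  Rrep g *m lift_mx Phi v *m adj (Rrep g) = lift_mx Phi (lam g *m v).
Proof.
move=> itw; rewrite /lift_mx mulmx_sumr mulmx_suml.
under eq_bigr => a _ do rewrite -scalemxAr -scalemxAl itw scaler_sumr.
rewrite exchange_big; apply: eq_bigr => b _ /=.
by rewrite mxE scaler_suml; apply: eq_bigr => a _; rewrite scalerA mulrC.
Qed.

Lemma lift_mx_cint Phi (F : G -> 'cV[R[i]]_d) : cont_mx F ->
  cintmx I (fun g => lift_mx Phi (F g)) = lift_mx Phi (cintmx I F).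
Proof.
move=> cF; apply/matrixP => i j; rewrite mxE /lift_mx summxE.
under eq_fun do rewrite summxE.
rewrite (cint_sum HI) => [|a]; last first.
  under eq_fun do rewrite mxE.
  by apply: ccontM; [exact: cF|exact: ccont_cst].
apply: eq_bigr => a _; rewrite !mxE mulrC -(cintZ HI); last exact: cF.
by under eq_fun do rewrite mxE mulrC.
Qed.

Lemma lift_mx_LD Phi v k l : (forall a, in_LD U blk (Phi a)) ->
  blk k != blk l -> ent (lift_mx Phi v) k l = 0.
Proof.
move=> inLD kl; rewrite /braket /lift_mx mulmx_sumr mulmx_suml summxE big1 // => a _.
by rewrite -scalemxAr -scalemxAl mxE [X in _ * X](inLD a k l kl) mulr0.
Qed.

Variable Phi : 'I_d -> 'M[R[i]]_n.
Hypotheses (itw : intertwiner Rrep lam Phi) (li : lin_indep Phi)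
  (inLD : forall a, in_LD U blk (Phi a)).

(* The projection onto the [H]-fixed vectors is built without integrating over
   [H]: it is the product of the Lagrange factors [(lam h - mu) / (1 - mu)],
   where [mu] runs over the nontrivial weights of the off-diagonal matrix units. *)
Lemma offdiag_killer (s : seq ('I_n * 'I_n)) : exists Q : 'M[R[i]]_d,
  [/\ forall v k, ent (lift_mx Phi (Q *m v)) k k = ent (lift_mx Phi v) k k,
      forall v k l, (k, l) \in s -> k != l -> ent (lift_mx Phi (Q *m v)) k l = 0
    & forall v : 'cV_d, (forall h, Hs h -> lam h *m v = v) -> Q *m v = v].
Proof.
elim: s => [|[k0 l0] s [Q [Qd Qo Qf]]].
  by exists 1%:M; split => // v; rewrite mul1mx.
(* A diagonal pair is excluded, and a pair joining two blocks has a zero entry already; in both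
   cases [Q] is kept. *)
have skip : (k0 != l0 -> forall v, ent (lift_mx Phi (Q *m v)) k0 l0 = 0) ->
   forall v k l, (k, l) \in (k0, l0) :: s -> k != l ->
     ent (lift_mx Phi (Q *m v)) k l = 0.
  move=> h v k l; rewrite inE => /orP[/eqP[-> ->] kl|]; [exact: h|exact: Qo].
have [kl0|kl0] := eqVneq k0 l0.
  by exists Q; split=> //; apply: skip; rewrite kl0 eqxx.
have [bkl|bkl] := eqVneq (blk k0) (blk l0); last first.
  by exists Q; split=> //; apply: skip => _ v; apply: lift_mx_LD.
have [_ _ _ /(_ _ _ kl0 bkl)[h [Hh neq]]] := HW.
have [chi1 wt] := ent_weight Hh.
have [mu muE] : exists mu, mu = ent (Rrep h) k0 k0 * (ent (Rrep h) l0 l0)^*.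
  by eexists.
have mu1 : 1 - mu != 0.
  by rewrite muE subr_eq0 eq_sym; exact: ent_weight_neq1.
(* The new factor multiplies entry (k, l) by (weight - mu)/(1 - mu): this is one on the diagonal and
   zero at (k0, l0), and earlier zeros stay. *)
have step v k l : ent (lift_mx Phi ((1 - mu)^-1 *: (lam h - mu%:M) *m v)) k l =
    (1 - mu)^-1 * (ent (Rrep h) k k * (ent (Rrep h) l l)^* - mu)
    * ent (lift_mx Phi v) k l.
  rewrite -scalemxAl lift_mxZ mulmxBl mul_scalar_mx -scaleNr lift_mxD lift_mxZ.
  rewrite -lift_mx_intertwiner // -mulrA mulrBl -wt.
  rewrite /braket -scalemxAr -scalemxAl mxE mulmxDr mulmxDl mxE.
  by rewrite -scalemxAr -scalemxAl [in X in _ * (_ + X)]mxE mulNr.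
exists ((1 - mu)^-1 *: (lam h - mu%:M) *m Q); split=> [v k|v k l kls kl|v fv].
- by rewrite -mulmxA step Qd chi1 mulVf // mul1r.
- rewrite -mulmxA step; move: kls; rewrite inE => /orP[/eqP[-> ->]|kls].
    by rewrite -muE subrr mulr0 mul0r.
  by rewrite Qo // mulr0.
- rewrite -mulmxA Qf // -scalemxAl mulmxBl fv // mul_scalar_mx.
  by rewrite -{1}[v]scale1r -scalerBl scalerA mulVf ?scale1r.
Qed.

Variables (dH : nat) (HdH : fixdim lam Hs dH).

(** [Q] keeps diagonal entries and kills the others, so it realises dephasing. It is also idempotent
    with image the H-fixed vectors, so its trace is their dimension. *)
Lemma AW_lift_mx : exists Q : 'M[R[i]]_d,
  (forall v, AW U (lift_mx Phi v) = lift_mx Phi (Q *m v)) /\ \tr Q = dH%:R.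
Proof.
have [Q [Qd Qo Qf]] := offdiag_killer (enum {: 'I_n * 'I_n}).
have off v k l : k != l -> ent (lift_mx Phi (Q *m v)) k l = 0.
  by apply: Qo; rewrite mem_enum.
(* Diagonal entries have weight [chi k * (chi k)^* = 1], so a diagonal operator is H-fixed;
   injectivity of [lift_mx Phi] brings this back to V^lam. *)
have Qfix (v : 'cV[R[i]]_d) h : Hs h -> lam h *m (Q *m v) = Q *m v.
  move=> Hh; apply: (lift_mx_inj li); rewrite -lift_mx_intertwiner //.
  have [chi1 wt] := ent_weight Hh; apply: ent_inj => k l; rewrite wt.
  by have [->|kl] := eqVneq k l; [rewrite chi1 mul1r|rewrite off ?mulr0].
exists Q; split=> [v|].
  apply: ent_inj => k l; rewrite ent_AW.
  by have [->|kl] := eqVneq k l; [rewrite Qd|rewrite off].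
(* Every column of [Q] is H-fixed, hence fixed by [Q]. *)
have QQ : Q *m Q = Q.
  apply/matrixP => i j.
  have := Qf (Q *m delta_mx j 0) (Qfix _); rewrite mulmxA.
  by rewrite -!colE => /colP/(_ i); rewrite !mxE.
rewrite mxtrace_idempotent //; congr (_ %:R).
(* The ranks agree by mutual inclusion of row spaces; [B] holds the fixed vectors as rows, whence
   [Q^T]. *)
case: HdH => B [fB <-]; rewrite -mxrank_tr; apply/eqP; rewrite eqn_leq.
apply/andP; split; apply: mxrankS.
- apply/row_subP => i; apply/fB => h Hh.
  by rewrite -tr_col trmxK colE Qfix.
- apply/row_subP => i.
  have /fB fb : (row i B <= B)%MS by exact: row_sub.
  by rewrite -[row i B]trmxK -(Qf _ fb) trmx_mul submxMl.
Qed.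

Hypotheses (d_gt0 : (0 < d)%N) (Hlam : irrep gr lam).

(** Equivariance pulls the integrand back to [adj (lam g) *m Q *m lam g] on V^lam, whose average is
    the scalar tr Q / d. *)
Lemma MW_lift_mx v :
  MW I Rrep U (lift_mx Phi v) = (dH%:R / d%:R) *: lift_mx Phi v.
Proof.
have [Q [AWQ trQ]] := AW_lift_mx.
case: (HR) => _ RU _; case: (Hlam) => -[_ lamU lamC] _.
have e g : adj (Rrep g) *m AW U (Rrep g *m lift_mx Phi v *m adj (Rrep g)) *m Rrep g =
    lift_mx Phi (adj (lam g) *m Q *m lam g *m v).
  rewrite lift_mx_intertwiner // AWQ.
  (* With the dephased vector written as [lam g] of another one, equivariance can be read backwards
     and the outer conjugation cancels. *)
  rewrite (_ : Q *m (lam g *m v) = lam g *m (adj (lam g) *m Q *m lam g *m v)).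
    rewrite -lift_mx_intertwiner // -!mulmxA RU mulmx1.
    by rewrite mulmxA RU mul1mx.
  by rewrite !mulmxA (unitary_mulC (lamU g)) mul1mx.
rewrite /MW; under eq_fun do rewrite e.
have cK := cont_mx_conjV Q lamC.
rewrite lift_mx_cint; last by apply: cont_mx_mul => //; exact: cont_mx_cst.
rewrite (cintmx_mulr HI) // (dual_twirl_scalar d_gt0 Hlam HI) trQ mul_scalar_mx.
exact: lift_mxZ.
Qed.

End Isotypic.

(** Linearity reduces to a single copy of [lam], and the scalar of [MW_lift_mx] is the same for all
    copies. *)
Lemma MW_isotypic (R : realType) (G : topologicalType) (gr : cgroup G)
  (I : (G -> R) -> R) (HI : haar_integral gr I)
  (n : nat) (Rrep : G -> 'M[R[i]]_n) (HR : unitary_rep gr Rrep)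
  (Hs : set G) (m : nat) (U : 'M[R[i]]_n) (blk : 'I_n -> 'I_m)
  (HW : NDCSE gr Rrep Hs U blk)
  (d : nat) (lam : G -> 'M[R[i]]_d) (Hlam : irrep gr lam)
  (dH : nat) (HdH : fixdim lam Hs dH) (d_gt0 : (0 < d)%N) X :
  in_isotypic Rrep U blk lam X -> MW I Rrep U X = (dH%:R / d%:R) *: X.
Proof.
move=> [p [Phi [hPhi [x ->]]]]; rewrite (MW_sum HI HR) scaler_sumr.
apply: eq_bigr => j _; have [itw li inLD] := hPhi j.
have -> : \sum_a x j a *: Phi j a = lift_mx (Phi j) (\col_a x j a).
  by apply: eq_bigr => a _; rewrite mxE.
exact: (MW_lift_mx HI HR HW itw li inLD HdH).
Qed.

(** * Operator norm, spectral decomposition and expectation values *)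

Section OperatorNorm.
Set Implicit Arguments.
Unset Strict Implicit.
Variables (R : realType) (n : nat).
Implicit Types (A : 'M[R[i]]_n) (v : 'cV[R[i]]_n).

(** Needed for [sup] to dominate its set. Coordinates of a unit vector have real and imaginary parts
    of size at most 1, so those of coordinate i of [A *m v] are at most [S i]. *)
Lemma has_ubound_opnorm A : has_ubound
  [set Num.sqrt (vnorm2 (A *m v)) | v in [set v : 'cV[R[i]]_n | vnorm2 v = 1]]%classic.
Proof.
pose S i := \sum_j (`|reC (A i j)| + `|imC (A i j)|).
exists (Num.sqrt (\sum_i (S i ^+ 2 + S i ^+ 2))) => _ [v /= v1 <-].
apply: ler_wsqrtr; rewrite vnorm2E; apply: ler_sum => i _.
have coord j : `|reC (v j 0)| <= 1 /\ `|imC (v j 0)| <= 1.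
  have : reC (v j 0) ^+ 2 + imC (v j 0) ^+ 2 <= 1.
    rewrite -v1 vnorm2E (bigD1 j) //= lerDl; apply: sumr_ge0 => k _.
    by rewrite addr_ge0 ?sqr_ge0.
  have := sqr_ge0 (reC (v j 0)); have := sqr_ge0 (imC (v j 0)) => h1 h2 h3.
  by split; rewrite -(ler_pXn2r (n := 2)) ?nnegrE // expr1n real_normK ?num_real;
    lra.
have S0 : 0 <= S i by apply: sumr_ge0 => j _; rewrite addr_ge0.
have boundM (a b x y : R) : `|x| <= 1 -> `|y| <= 1 -> `|a * x + b * y| <= `|a| + `|b|.
  move=> x1 y1; apply: le_trans (ler_normD _ _) _; rewrite !normrM.
  by apply: lerD; rewrite ler_piMr.
rewrite mxE; apply: lerD; rewrite -[leLHS]real_normK ?num_real //;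
  rewrite ler_pXn2r ?nnegrE //.
- rewrite reC_sum; apply: le_trans (ler_norm_sum _ _ _) _; apply: ler_sum => j _.
  have [? ?] := coord j; rewrite reCM -mulNr -[`|imC (A i j)|]normrN; exact: boundM.
- rewrite /imC raddf_sum /=; apply: le_trans (ler_norm_sum _ _ _) _.
  apply: ler_sum => j _; have [? ?] := coord j.
  by rewrite -/(imC _) imCM; apply: boundM.
Qed.

Lemma le_opnorm A v : vnorm2 v = 1 -> Num.sqrt (vnorm2 (A *m v)) <= opnorm A.
Proof. by move=> v1; apply: (ub_le_sup (has_ubound_opnorm A)); exists v. Qed.

Lemma vnorm2_addZ (u v : 'cV[R[i]]_n) (r : R) : vnorm2 (u + r%:C%C *: v) =
  vnorm2 u + 2 * r * reC ((adj v *m u) 0 0) + r ^+ 2 * vnorm2 v.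
Proof.
rewrite !vnorm2E mxE reC_sum !mulr_sumr -!big_split; apply: eq_bigr => i _ /=.
rewrite mxE [(_ *: v) i 0]mxE reCD imCD adjE !reCM imCM reC_conj imC_conj /=.
by ring.
Qed.

Lemma reC_braket_sqr_le A v : vnorm2 v = 1 ->
  reC (braket v A v) ^+ 2 <= vnorm2 (A *m v).
Proof.
(* Cauchy-Schwarz: r = -Re <v|A|v> minimises |A v + r v|^2, and the minimum is |A v|^2 - r^2. *)
move=> v1; have := vnorm2_ge0 (A *m v + (- reC (braket v A v))%:C%C *: v).
by rewrite vnorm2_addZ mulmxA -/(braket v A v) v1; lra.
Qed.

Lemma braket_opnorm A v : vnorm2 v = 1 -> `|reC (braket v A v)| <= opnorm A.
Proof.
move=> v1; apply: le_trans (le_opnorm A v1).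
by rewrite -sqrtr_sqr; apply: ler_wsqrtr; exact: reC_braket_sqr_le.
Qed.

Lemma opnorm_ge0 A : 0 <= opnorm A.
Proof.
have [[v v1]|h] := pselect (exists v : 'cV[R[i]]_n, vnorm2 v = 1).
  by apply: le_trans (le_opnorm A v1); exact: sqrtr_ge0.
(* Without unit vectors, that is in dimension zero, the supremum is over the empty set and equals
   [0]. *)
rewrite /opnorm (_ : [set _ | _ in _]%classic = set0) ?sup0 //.
by rewrite -subset0 => _ [v /= v1 _]; case: h; exists v.
Qed.

Lemma sum_braket_unitary (V A : 'M[R[i]]_n) : adj V *m V = 1%:M ->
  \sum_k braket (wvec V k) A (wvec V k) = \tr A.
Proof.
move=> VV; under eq_bigr do rewrite braketE.
by rewrite -[LHS]/(\tr _) mxtrace_mulC mulmxA (unitary_mulC VV) mul1mx.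
Qed.

Lemma hermitian_diagonalizable A : is_hermitian A -> exists V : 'M[R[i]]_n,
  adj V *m V = 1%:M /\ forall k l, k != l -> braket (wvec V k) A (wvec V l) = 0.
Proof.
move=> hA; pose P := spectralmx A.
have tadj (B : 'M[R[i]]_n) : map_mx Num.conj (trmx B) = adj B.
  by apply/matrixP => i j; rewrite !mxE.
have /unitarymxP PP : P \is unitarymx by exact: spectral_unitarymx.
have /orthomx_spectralP AE : A \is normalmx by apply/normalmxP; rewrite tadj hA.
(* The spectral theorem gives A = P^-1 D P with P unitary and D diagonal, so the eigenvectors are
   the columns of [adj P]. *)
rewrite tadj in PP; exists (adj P); rewrite adjK; split=> // k l kl.
rewrite braketE adjK [in LHS]AE -/P invmx_unitary ?spectral_unitarymx // tadj.
by rewrite !mulmxA PP mul1mx -mulmxA PP mulmx1 mxE (negbTE kl).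
Qed.

(** In an eigenbasis of [rho] the trace is a convex combination of diagonal entries of [A], whose
    real parts are bounded by the operator norm. *)
Lemma mxtrace_density_opnorm rho A : density_matrix rho ->
  `|reC (\tr (rho *m A))| <= opnorm A.
Proof.
move=> [[hrho prho] trrho]; have [V [VV Vd]] := hermitian_diagonalizable hrho.
pose r k := braket (wvec V k) rho (wvec V k).
have r0 k : 0 <= r k by exact: prho.
have imr k : imC (r k) = 0 by apply: conj_imC0; rewrite /r braket_conj hrho.
have -> : \tr (rho *m A) = \sum_k r k * braket (wvec V k) A (wvec V k).
  rewrite -(sum_braket_unitary _ VV); apply: eq_bigr => k _; rewrite !braketE.
  rewrite (_ : adj V *m _ *m V = (adj V *m rho *m V) *m (adj V *m A *m V)).
    rewrite mxE (bigD1 k) //= big1 ?addr0 -?braketE // => j jk.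
    by rewrite -braketE Vd ?mul0r // eq_sym.
  by rewrite !mulmxA -(mulmxA _ V) (unitary_mulC VV) mulmx1.
rewrite reC_sum; apply: le_trans (ler_norm_sum _ _ _) _.
have sr : \sum_k reC (r k) = 1.
  by rewrite -reC_sum /r sum_braket_unitary // trrho.
rewrite -[leRHS]mul1r -sr mulr_suml; apply: ler_sum => k _.
rewrite reCM imr mul0r subr0 normrM ger0_norm ?ge0_reC //.
by apply: ler_wpM2l; [exact: ge0_reC|apply: braket_opnorm; exact: vnorm2_wvec].
Qed.

End OperatorNorm.

(* An eigenoperator of a map [M] and of its adjoint is an eigenoperator of the
   pseudoinverse: [P M] is Hermitian and fixes [o], hence also fixes [o^dag]. *)
Lemma pinv_eigen (R : realType) N (M P : 'M[R[i]]_N) (o : 'rV[R[i]]_N) a :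
  a != 0 -> is_pinv M P -> o *m M = a *: o -> M *m adj o = a *: adj o ->
  P *m adj o = a^-1 *: adj o.
Proof.
move=> a0 [MPM _ _ PMh] oM Mo.
have oPM : o *m (P *m M) = o.
  have -> : o = a^-1 *: (o *m M) by rewrite oM scalerA mulVf ?scale1r.
  by rewrite -scalemxAl -mulmxA [M *m _]mulmxA MPM.
have : P *m M *m adj o = adj o by rewrite -PMh -adjM oPM.
rewrite -mulmxA Mo -scalemxAr => e.
by rewrite -{2}e scalerA mulVf ?scale1r.
Qed.

(** * The estimator and its second moment *)

Section Estimator.
Set Implicit Arguments.
Unset Strict Implicit.
Variables (R : realType) (G : topologicalType) (gr : cgroup G).
Variables (I : (G -> R) -> R) (HI : haar_integral gr I).
Variables (n : nat) (Rrep : G -> 'M[R[i]]_n) (HR : unitary_rep gr Rrep).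
Variables (U O : 'M[R[i]]_n) (UU : adj U *m U = 1%:M) (HO : is_hermitian O).
Variables (a : R) (a0 : 0 < a) (MWO : MW I Rrep U O = a%:C%C *: O).

Let aC0 : a%:C%C != 0 :> R[i].
Proof. by rewrite fmorph_eq0 gt_eqF. Qed.

(** [O] is an eigenoperator of the channel matrix on both sides, so the pseudoinverse contributes
    1/a and cyclicity leaves <w|R(g) O R(g)^dag|w>, which is [outprob] with [O] in place of a
    state. *)
Lemma ohatE (Pinv : 'M[R[i]]_(n * n)) g k : is_pinv (MWmat I Rrep U) Pinv ->
  ohat Rrep U Pinv O g k = a^-1 * outprob Rrep U O g k.
Proof.
move=> hP; rewrite /ohat /outprob; set Y := adj _ *m _ *m _.
have oM : mxvec O *m MWmat I Rrep U = a%:C%C *: mxvec O.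
  by rewrite (mul_rV_MWmat HI HR) MWO linearZ.
have Mo : MWmat I Rrep U *m adj (mxvec O) = a%:C%C *: adj (mxvec O).
  (* Row i is the channel applied to the operator [X] whose vectorisation is the i-th unit vector;
     [mxtrace_MWC] transfers the channel to [O]. *)
  apply/row_matrixP => i; rewrite !rowE -scalemxAr mulmxA.
  rewrite -[delta_mx 0 i]vec_mxK; set X := vec_mx _.
  rewrite (mul_rV_MWmat HI HR); apply/matrixP => s t; rewrite !ord1 [RHS]mxE.
  rewrite -!mxtrace_mxvec HO (mxtrace_MWC HI HR) MWO -scalemxAr mxtraceZ.
  by rewrite mxtrace_mulC.
have tr : \tr (O *m apply_mat Pinv Y) = (a^-1)%:C%C * \tr (O *m Y).
  rewrite -{1}HO mxtrace_mxvec /apply_mat vec_mxK -mulmxA.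
  rewrite (pinv_eigen aC0 hP oM Mo) -scalemxAr mxE -mxtrace_mxvec HO.
  by rewrite fmorphV.
rewrite tr reCM /= mul0r subr0; congr (_ * reC _).
by rewrite /Y !mulmxA mxtrace_mulC !mulmxA -mulmxA mxtrace_outer.
Qed.

Local Notation q := (outprob Rrep U O).

Lemma outprob_braket (X : 'M[R[i]]_n) g k : is_hermitian X ->
  braket (wvec U k) (Rrep g *m X *m adj (Rrep g)) (wvec U k) =
  (outprob Rrep U X g k)%:C%C.
Proof.
by move=> hX; apply: conj_reC; rewrite braket_conj !adjM adjK hX mulmxA.
Qed.

Lemma outprob_le_opnorm (X : 'M[R[i]]_n) g k :
  `|outprob Rrep U X g k| <= opnorm X.
Proof.
case: HR => _ RU _; rewrite /outprob braket_conjmx; apply: braket_opnorm.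
rewrite vnorm2_unitary ?vnorm2_wvec // adjK; exact: unitary_mulC.
Qed.

Lemma outprob_continuous (X : 'M[R[i]]_n) k :
  continuous (fun g => outprob Rrep U X g k).
Proof.
case: HR => _ _ cR.
by have [] := @ccont_braket R G n _ (wvec U k) (cont_mx_conj X cR).
Qed.

Lemma outprob_ge0 (X : 'M[R[i]]_n) g k : is_psd X -> 0 <= outprob Rrep U X g k.
Proof. by move=> [_ pX]; apply: ge0_reC; rewrite braket_conjmx. Qed.

Lemma sum_outprob (X : 'M[R[i]]_n) g : \sum_k outprob Rrep U X g k = reC (\tr X).
Proof.
case: HR => _ RU _; rewrite -reC_sum sum_braket_unitary //.
by rewrite mxtrace_mulC mulmxA RU mul1mx.
Qed.

(** The average is Re tr(X M_W(O)), and [O] is an eigenoperator. It serves with X = [rho] in the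
    semidefinite case and X = [O] in the orbit case. *)
Lemma haar_outprob_mul (X : 'M[R[i]]_n) : is_hermitian X ->
  I (fun g => \sum_k outprob Rrep U X g k * q g k) = a * reC (\tr (X *m O)).
Proof.
move=> hX; have := congr1 (@reC R) (mxtrace_MW HI HR U O X).
rewrite MWO -scalemxAr mxtraceZ reCM /= mul0r subr0 => ->.
congr I; apply/funext => g; rewrite reC_sum; apply: eq_bigr => k _.
by rewrite !outprob_braket // reCM /= mul0r subr0.
Qed.

Lemma outprob_opp g k : outprob Rrep U (- O) g k = - q g k.
Proof. by rewrite /outprob -reCN /braket !(mulmxN, mulNmx) mxE. Qed.

Variables (rho : 'M[R[i]]_n) (Hrho : density_matrix rho).
Local Notation p := (outprob Rrep U rho).

Let p_ge0 g k : 0 <= p g k.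
Proof. by case: Hrho => prho _; exact: outprob_ge0. Qed.

Let sum_p g : \sum_k p g k = 1.
Proof. by case: Hrho => _ trrho; rewrite sum_outprob trrho. Qed.

Let pX_continuous (e : nat) : continuous (fun g => \sum_k p g k * q g k ^+ e).
Proof.
apply: continuous_sumf => k; apply: continuousMf; first exact: outprob_continuous.
elim: e => [|e IHe]; first by under eq_fun do rewrite expr0; exact: cst_continuous.
under eq_fun do rewrite exprS; apply: continuousMf => //; exact: outprob_continuous.
Qed.

(** A sign [s] makes [s * q] nonnegative, so q^2 is at most ||O|| s q pointwise. The average of s q
    under [p] is a s Re tr(rho O), at most a ||O||. *)
Lemma second_moment_semidefinite : is_psd O \/ is_psd (- O) ->
  I (fun g => \sum_k p g k * q g k ^+ 2) <= opnorm O ^+ 2 * a.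
Proof.
move=> psd.
have [s s1 sq] : exists2 s : R, `|s| = 1 & forall g k, 0 <= s * q g k.
  case: psd => psd; [exists 1|exists (- 1)]; rewrite ?normrN ?normr1 // => g k.
    by rewrite mul1r outprob_ge0.
  by rewrite mulN1r -outprob_opp outprob_ge0.
have s2 : s * s = 1 by rewrite -expr2 -real_normK ?num_real // s1 expr1n.
case: (HI) => _ hZ _ _ _; have c1 := @pX_continuous 1.
have N0 := opnorm_ge0 O.
have : I (fun g => \sum_k p g k * q g k ^+ 2) <=
       I (fun g => opnorm O * s * \sum_k p g k * q g k ^+ 1).
  apply: (haar_le HI) => [||g]; first exact: pX_continuous.
    by apply: (@continuousMf _ _ (fun=> _)) => //; exact: cst_continuous.
  rewrite mulr_sumr; apply: ler_sum => k _; rewrite expr1.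
  have -> : opnorm O * s * (p g k * q g k) = p g k * (opnorm O * (s * q g k)).
    by ring.
  apply: ler_wpM2l => //.
  have -> : q g k ^+ 2 = (s * q g k) * (s * q g k).
    by rewrite mulrACA s2 mul1r.
  apply: ler_wpM2r => //; apply: le_trans (ler_norm _) _.
  by rewrite normrM s1 mul1r outprob_le_opnorm.
move=> /le_trans; apply; rewrite hZ //.
under eq_fun do under eq_bigr do rewrite expr1.
rewrite haar_outprob_mul; last by case: Hrho => -[].
have -> : opnorm O * s * (a * reC (\tr (rho *m O))) =
  opnorm O * (s * reC (\tr (rho *m O))) * a by ring.
apply: ler_wpM2r; first exact: ltW.
rewrite expr2; apply: ler_wpM2l => //; apply: le_trans (ler_norm _) _.
by rewrite normrM s1 mul1r mxtrace_density_opnorm.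
Qed.

(* The orbit of [O] meets the diagonal operators with probability [a]: on that
   event the squared diagonal of [R g O (R g)^dag] sums to [1], elsewhere to [0]. *)
Lemma second_moment_orbit :
  \tr (O *m O) = 1 ->
  (forall g, let X := Rrep g *m O *m adj (Rrep g) in
     (forall k k', k != k' -> braket (wvec U k) X (wvec U k') = 0) \/
     (forall k, braket (wvec U k) X (wvec U k) = 0)) ->
  I (fun g => \sum_k p g k * q g k ^+ 2) <= opnorm O ^+ 2 * a.
Proof.
move=> trOO dich; case: (HI) => _ hZ _ _ _.
have cq : continuous (fun g => \sum_k q g k * q g k).
  by apply: continuous_sumf => k; apply: continuousMf; exact: outprob_continuous.
(* The sum of the squares of [q] over the outcomes is the indicator of the event, so the comparison
   stays among continuous functions; its average is a tr(O^2) = a. *)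
have : I (fun g => \sum_k p g k * q g k ^+ 2) <=
       I (fun g => opnorm O ^+ 2 * \sum_k q g k * q g k).
  apply: (haar_le HI) => [||g]; first exact: pX_continuous.
    by apply: (@continuousMf _ _ (fun=> _)) => //; exact: cst_continuous.
  case: (dich g) => [diag|zero]; last first.
    have q0 k : q g k = 0 by rewrite /outprob zero.
    by rewrite !big1 ?mulr0 // => k _; rewrite q0 ?expr0n ?mulr0.
  have -> : \sum_k q g k * q g k = 1.
    rewrite -[RHS]/(reC 1) -trOO.
    set X := Rrep g *m O *m adj (Rrep g) in diag *.
    have trX : \tr (X *m X) = \tr (O *m O).
      case: HR => _ RU _; rewrite /X -!mulmxA [adj _ *m (_ *m _)]mulmxA RU mul1mx.
      by rewrite mxtrace_mulC -!mulmxA RU mulmx1.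
    rewrite -trX -(sum_braket_unitary _ UU) reC_sum; apply: eq_bigr => k _.
    rewrite braketE.
    rewrite (_ : adj U *m _ *m U = (adj U *m X *m U) *m (adj U *m X *m U)).
      rewrite mxE (bigD1 k) //= big1 => [|j jk].
        by rewrite addr0 -!braketE /X outprob_braket // reCM /= mul0r subr0.
      by rewrite -braketE diag ?mul0r // eq_sym.
    by rewrite !mulmxA -(mulmxA _ U) (unitary_mulC UU) mulmx1.
  rewrite mulr1 -[leRHS]mul1r -(sum_p g) mulr_suml; apply: ler_sum => k _.
  apply: ler_wpM2l => //; rewrite -[q g k ^+ 2]real_normK ?num_real //.
  by rewrite ler_pXn2r ?nnegrE ?opnorm_ge0 // outprob_le_opnorm.
move=> /le_trans; apply; rewrite hZ // haar_outprob_mul // trOO.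
by rewrite [reC 1]/(1 : R) mulr1.
Qed.

(** The squared mean is dropped, and the estimate q / a contributes a^-2, which turns B a into B /
    a. *)
Lemma est_variance_le (Pinv : 'M[R[i]]_(n * n)) B :
  is_pinv (MWmat I Rrep U) Pinv ->
  I (fun g => \sum_k p g k * q g k ^+ 2) <= B * a ->
  est_variance I Rrep U rho (ohat Rrep U Pinv O) <= B / a.
Proof.
move=> hP le; rewrite /est_variance.
apply: (@le_trans _ _ (est_expect I Rrep U rho
  (fun g k => ohat Rrep U Pinv O g k ^+ 2))); first by rewrite gerBl sqr_ge0.
case: (HI) => _ hZ _ _ _; rewrite /est_expect.
rewrite (_ : (fun g => _) = fun g => a^-1 ^+ 2 * \sum_k p g k * q g k ^+ 2).
  rewrite hZ; last exact: pX_continuous.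
  apply: (@le_trans _ _ (a^-1 ^+ 2 * (B * a))).
    by apply: ler_wpM2l => //; exact: sqr_ge0.
  by rewrite expr2 mulrCA -mulrA mulVf ?gt_eqF // mulr1.
apply/funext => g; rewrite mulr_sumr; apply: eq_bigr => k _.
by rewrite (ohatE _ _ hP) exprMn; ring.
Qed.

End Estimator.

(** * The variance bound under either condition *)

Theorem mainTheorem6
  (R : realType) (G : topologicalType) (gr : cgroup G)
  (I : (G -> R) -> R) (HI : haar_integral gr I)
  (n : nat) (Rrep : G -> 'M[R[i]]_n) (HR : unitary_rep gr Rrep)
  (Hs : set G) (HHs : closed_abelian_subgroup gr Hs)
  (m : nat) (U : 'M[R[i]]_n) (blk : 'I_n -> 'I_m)
  (HW : NDCSE gr Rrep Hs U blk)
  (rho : 'M[R[i]]_n) (Hrho : density_matrix rho)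
  (d : nat) (lam : G -> 'M[R[i]]_d) (Hlam : irrep gr lam)
  (dH : nat) (HdH : fixdim lam Hs dH) (HaH : (0 < dH)%N)
  (O : 'M[R[i]]_n) (HO : is_hermitian O) (HOiso : in_isotypic Rrep U blk lam O)
  (Hcase : is_psd O \/ is_psd (- O) \/ cond_ii Rrep U blk lam O)
  (Pinv : 'M[R[i]]_(n * n)) (HPinv : is_pinv (MWmat I Rrep U) Pinv) :
  est_variance I Rrep U rho (ohat Rrep U Pinv O)
    <= opnorm O ^+ 2 / ((dH%:R : R) / (d%:R : R)).
Proof.
have d_gt0 : (0 < d)%N.
  by case: HdH => B [_ rB]; apply: leq_trans HaH _; rewrite -rB rank_leq_row.
have a0 : 0 < dH%:R / d%:R :> R by rewrite divr_gt0 ?ltr0n.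
have UU : adj U *m U = 1%:M by case: HW.
have MWO : MW I Rrep U O = (dH%:R / d%:R)%:C%C *: O.
  rewrite (MW_isotypic HI HR HW Hlam HdH d_gt0 HOiso); congr (_ *: _).
  by rewrite fmorph_div !rmorph_nat.
apply: (est_variance_le HI HR HO a0 MWO HPinv).
case: Hcase => [psd|[psd|]].
- by apply: (second_moment_semidefinite HI HR UU HO a0 MWO Hrho); left.
- by apply: (second_moment_semidefinite HI HR UU HO a0 MWO Hrho); right.
move=> [b [Ob [_ [orth [herm _]] [orbit dich] [beta OE]]]].
(* Orthonormality gives tr(O^2) = 1, and each rotated [O] is some [Ob beta'], hence diagonal or of
   zero diagonal. *)
apply: (second_moment_orbit HI HR UU HO MWO Hrho).
  by rewrite -{1}HO OE orth eqxx.
by move=> g X; rewrite /X OE; have [beta' ->] := orbit g beta; exact: dich.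
Qed.
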